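(* Let $F$ be a field, let $D$ be a quaternion division algebra over $F$, and let $c\in D^\times$ with $c\notin F$. Then the Cayley-Dickson doublings $\mathrm{Cay}(D,c)$, $\mathrm{Cay}_m(D,c)$ and $\mathrm{Cay}_r(D,c)$ are division algebras.
   Context: All algebras are finite-dimensional and not necessarily associative. An $F$-algebra $A\neq 0$ is a division algebra if for every nonzero $a\in A$ the left multiplication $x\mapsto ax$ and the right multiplication $x\mapsto xa$ are bijective. For a quaternion algebra $D$ over $F$ with canonical involution $x\mapsto\bar x$ and $c\in D^\times\setminus F$, the $F$-vector space $D\oplus D$ becomes a unital $F$-algebra with unit $(1,0)$ under each of the following multiplications ($u,v,u',v'\in D$): $\mathrm{Cay}(D,c)$: $(u,v)(u',v')=(uu'+c\,\bar{v'}v,\ v'u+v\bar{u'})$; $\mathrm{Cay}_m(D,c)$: $(u,v)(u',v')=(uu'+\bar{v'}cv,\ v'u+v\bar{u'})$; $\mathrm{Cay}_r(D,c)$: $(u,v)(u',v')=(uu'+\bar{v'}v\,c,\ v'u+v\bar{u'})$. *)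

(* Defs.v *)
From HB Require Import structures.
From mathcomp Require Import all_boot all_order all_algebra all_field.

Set Implicit Arguments.
Unset Strict Implicit.
Unset Printing Implicit Defensive.

Import GRing.Theory.
Local Open Scope ring_scope.

(* A finite-dimensional, not necessarily associative or unital, F-algebra is
   a vectType A together with a bilinear multiplication on A. *)
Definition division_algebra (F : fieldType) (A : vectType F)
    (mul : {bilinear A -> A -> A}) : Prop :=
  (exists a : A, a != 0) /\
  (forall a : A, a != 0 ->
     bijective (fun x => mul a x) /\ bijective (fun x => mul x a)).

Section AssociativeAlgebra.
Variables (F : fieldType) (D : falgType F).

Definition amul (x y : D) : D := x * y.

Fact amul_bilinear : bilinear_for *:%R *:%R amul.
Proof.
by split=> [y|x] a u v; rewrite /amul /= ?mulrDl ?mulrDr -?scalerAl -?scalerAr.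
Qed.

HB.instance Definition _ :=
  bilinear_isBilinear.Build F D D D *:%R *:%R amul amul_bilinear.

Definition central_algebra : Prop := 'Z({:D})%VS = 1%VS.

(* D is unital, so its two-sided ideals are automatically subspaces. *)
Definition simple_algebra : Prop :=
  forall I : {vspace D},
    (forall a x : D, x \in I -> a * x \in I /\ x * a \in I) ->
    I = 0%VS \/ I = {:D}%VS.

Definition quaternion_algebra : Prop :=
  [/\ \dim {:D} = 4%N, central_algebra & simple_algebra].

(* The canonical involution of a quaternion algebra is its standard (scalar)
   involution: the F-linear involutive anti-automorphism whose norms
   x * sigma x are scalars, so that sigma x = Trd(x) - x and
   x * sigma x = Nrd(x).  This is valid in every characteristic; such a map
   exists on every quaternion algebra and is unique
   (canonical_involution_uniq). *)
Definition canonical_involution (sigma : {linear D -> D}) : Prop :=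
  [/\ forall x y : D, sigma (x * y) = sigma y * sigma x,
      involutive sigma &
      forall x : D, x * sigma x \in 1%VS].

Lemma canonical_involution1 (sigma : {linear D -> D}) :
  canonical_involution sigma -> sigma 1 = 1.
Proof.
by case=> sM sK _; rewrite -[RHS]sK -[in RHS](mulr1 (sigma 1)) sM sK mulr1.
Qed.

Lemma canonical_involution_trace (sigma : {linear D -> D}) (x : D) :
  canonical_involution sigma -> x + sigma x \in 1%VS.
Proof.
move=> sC; have s1 := canonical_involution1 sC; case: sC => _ _ sN.
have D1 : (1 : D) \in 1%VS by exact: memv_line.
have E : (x + 1) * sigma (x + 1) = (x + sigma x) + (x * sigma x + 1).
  rewrite linearD s1 mulrDr mulrDl mulr1 mul1r.
  by rewrite (AC (2*2) ((3*2)*(1*4))).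
have := memvB (sN (x + 1)) (memvD (sN x) D1).
by rewrite E addrK.
Qed.

Lemma canonical_involution_uniq (sigma tau : {linear D -> D}) :
  canonical_involution sigma -> canonical_involution tau -> sigma =1 tau.
Proof.
move=> sC tC x; have [x1|xN1] := boolP (x \in 1%VS).
  have /vlineP[k ->] := x1.
  by rewrite !linearZ /= (canonical_involution1 sC) (canonical_involution1 tC).
have: sigma x - tau x \in 1%VS.
  have := memvB (canonical_involution_trace x sC)
                (canonical_involution_trace x tC).
  by rewrite opprD addrACA subrr add0r.
case/vlineP=> k Ek; apply/eqP; rewrite -subr_eq0 Ek scaler_eq0 oner_eq0 orbF.
apply/negPn/negP=> k0; case/negP: xN1.
have [[_ _ sN] [_ _ tN]] := (sC, tC).
have /(memvZ k^-1) := memvB (sN x) (tN x).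
by rewrite -mulrBr Ek -scalerAr mulr1 scalerA mulVf // scale1r.
Qed.

End AssociativeAlgebra.

Section CayleyDickson.
Variables (F : fieldType) (D : falgType F) (sigma : {linear D -> D}) (c : D).

Definition Cay (p q : D * D) : D * D :=
  let: (u, v) := p in let: (u', v') := q in
  (u * u' + c * sigma v' * v, v' * u + v * sigma u').

Definition Cay_m (p q : D * D) : D * D :=
  let: (u, v) := p in let: (u', v') := q in
  (u * u' + sigma v' * c * v, v' * u + v * sigma u').

Definition Cay_r (p q : D * D) : D * D :=
  let: (u, v) := p in let: (u', v') := q in
  (u * u' + sigma v' * v * c, v' * u + v * sigma u').

Let lin := (linearP, mulrDl, mulrDr, scalerDr).

Fact Cay_bilinear : bilinear_for *:%R *:%R Cay.
Proof.
split=> [[u' v']|[u v]] a [x y] [z w]; congr (_, _) => /=;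
by rewrite !lin -?scalerAl -?scalerAr -?scalerAl addrACA.
Qed.

Fact Cay_m_bilinear : bilinear_for *:%R *:%R Cay_m.
Proof.
split=> [[u' v']|[u v]] a [x y] [z w]; congr (_, _) => /=;
by rewrite !lin -?scalerAl -?scalerAr -?scalerAl addrACA.
Qed.

Fact Cay_r_bilinear : bilinear_for *:%R *:%R Cay_r.
Proof.
split=> [[u' v']|[u v]] a [x y] [z w]; congr (_, _) => /=;
by rewrite !lin -?scalerAl -?scalerAr -?scalerAl addrACA.
Qed.

HB.instance Definition _ := bilinear_isBilinear.Build
  F (D * D)%type (D * D)%type (D * D)%type *:%R *:%R Cay Cay_bilinear.
HB.instance Definition _ := bilinear_isBilinear.Build
  F (D * D)%type (D * D)%type (D * D)%type *:%R *:%R Cay_m Cay_m_bilinear.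
HB.instance Definition _ := bilinear_isBilinear.Build
  F (D * D)%type (D * D)%type (D * D)%type *:%R *:%R Cay_r Cay_r_bilinear.

Lemma Cay_unit p :
  canonical_involution sigma -> Cay (1, 0) p = p /\ Cay p (1, 0) = p.
Proof.
move=> /canonical_involution1 s1; case: p => u v; rewrite /= s1 linear0.
by rewrite !(mulr0, mul0r, mul1r, mulr1, add0r, addr0).
Qed.

Lemma Cay_m_unit p :
  canonical_involution sigma -> Cay_m (1, 0) p = p /\ Cay_m p (1, 0) = p.
Proof.
move=> /canonical_involution1 s1; case: p => u v; rewrite /= s1 linear0.
by rewrite !(mulr0, mul0r, mul1r, mulr1, add0r, addr0).
Qed.

Lemma Cay_r_unit p :
  canonical_involution sigma -> Cay_r (1, 0) p = p /\ Cay_r p (1, 0) = p.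
Proof.
move=> /canonical_involution1 s1; case: p => u v; rewrite /= s1 linear0.
by rewrite !(mulr0, mul0r, mul1r, mulr1, add0r, addr0).
Qed.

End CayleyDickson.

(* Main.v *)
Require Import Defs.
From HB Require Import structures.
From mathcomp Require Import all_boot all_order all_algebra all_field.

Set Implicit Arguments.
Unset Strict Implicit.
Unset Printing Implicit Defensive.

Import GRing.Theory.
Local Open Scope ring_scope.

(* In finite dimension it suffices to exclude zero divisors.  If
   (u, v)(u', v') = 0 with v and v' nonzero, multiply the first component on
   the left by v' and substitute v' u = - v sigma(u') from the second one: the
   first component then says that N(u') v is v' times the twisted term, where
   N(x) = x sigma(x).  Solving for c in each of the three cases gives
   c = N(u') / N(v'), which lies in F. *)

Lemma linear_inj_bijective (F : fieldType) (A : vectType F)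
    (f : {linear A -> A}) :
  (forall x, f x = 0 -> x = 0) -> bijective f.
Proof.
move=> f0; have kf : lker (linfun f) == 0%VS.
  rewrite -subv0; apply/subvP=> x; rewrite memv_ker lfunE memv0 => /eqP/f0 ->.
  by [].
exists (linfun f)^-1%VF => x.
  by have := lker0_lfunK kf x; rewrite lfunE.
by have := lker0_lfunVK kf x; rewrite lfunE.
Qed.

(** One implication serves both sides: read directly it makes left multiplications injective, and by
    contraposition right ones; finite dimension then gives bijectivity. *)
Lemma division_algebra_nzd (F : fieldType) (A : vectType F)
    (mul : {bilinear A -> A -> A}) :
  (exists a : A, a != 0) ->
  (forall x y, mul x y = 0 -> x != 0 -> y = 0) ->
  division_algebra mul.
Proof.
move=> A0 nzd; split=> // a a0; split.
  by apply: (@linear_inj_bijective _ _ (mul a)) => x /nzd; apply.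
apply: (@linear_inj_bijective _ _ (applyr mul a)) => x /nzd xa0.
by apply/eqP; apply: contraNT a0 => /xa0 ->.
Qed.

Section Doubling.
Variables (F : fieldType) (D : falgType F) (sigma : {linear D -> D}).
Hypothesis hdiv : division_algebra (@amul F D).
Hypothesis hsigma : canonical_involution sigma.

Lemma division_algebra_mulf_eq0 (x y : D) : x * y = 0 -> x != 0 -> y = 0.
Proof.
move=> xy0 /(proj2 hdiv)[/bij_inj injx _].
by apply: injx; rewrite /= /amul xy0 mulr0.
Qed.

Lemma canonical_involution_neq0 (x : D) : x != 0 -> sigma x != 0.
Proof.
case: hsigma => _ sK _; apply: contraNneq => sx0.
by rewrite -[x]sK sx0 linear0.
Qed.

(** A nonzero [x] has nonzero norm because [sigma x] is nonzero and [D] has no zero divisors. *)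
Lemma canonical_involution_normr (x : D) :
  exists2 n : F, x * sigma x = n%:A & x != 0 -> n != 0.
Proof.
have [_ _ sN] := hsigma; have /vlineP[n En] := sN x; exists n => // x0.
apply: contraNneq (canonical_involution_neq0 x0) => n0; apply/eqP.
by apply: division_algebra_mulf_eq0 x0; rewrite En n0 scale0r.
Qed.

(** This is the previous norm taken at [sigma x]. Both orders are recorded because the doublings
    place [sigma w] on different sides. *)
Lemma canonical_involution_norml (x : D) :
  exists2 n : F, sigma x * x = n%:A & x != 0 -> n != 0.
Proof.
have [_ sK _] := hsigma; have [n En n0] := canonical_involution_normr (sigma x).
by exists n => [|/canonical_involution_neq0 //]; rewrite -En sK.
Qed.

(** Treats the three products at once, with [X v' v] as the twisted term. A zero divisor with [v]
    and [v'] nonzero would make [v' * X v' v] a scalar multiple of [v]. *)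
Lemma doubling_division_algebra (X : D -> D -> D)
    (mul : {bilinear (D * D)%type -> (D * D)%type -> (D * D)%type}) :
  (forall u v u' v' : D,
     mul (u, v) (u', v') = (u * u' + X v' v, v' * u + v * sigma u')) ->
  (forall w, X w 0 = 0) ->
  (forall (w v : D) (k : F), w != 0 -> v != 0 -> w * X w v <> k *: v) ->
  division_algebra mul.
Proof.
move=> mulE X0 XF; apply: division_algebra_nzd.
  by exists (1, 0); rewrite xpair_eqE oner_eq0.
move=> [u v] [u' v']; rewrite mulE => -[E1 E2] uv0.
(* Here [u] is nonzero, so the components [u * u'] and [v' * u] force [u'] and [v'] to vanish. *)
have [v0|v0] := eqVneq v 0.
  move: E1 E2 uv0; rewrite v0 X0 mul0r !addr0 xpair_eqE eqxx andbT => E1 E2 u0.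
  rewrite (division_algebra_mulf_eq0 E1 u0).
  have [->//|v'0] := eqVneq v' 0.
  by case/eqP: u0; apply: division_algebra_mulf_eq0 E2 v'0.
(* The second component reduces to [v * sigma u' = 0], hence [u' = 0]. *)
have [v'0|v'0] := eqVneq v' 0.
  move: E2; rewrite v'0 mul0r add0r => /division_algebra_mulf_eq0/(_ v0) su'.
  have [->//|/canonical_involution_neq0] := eqVneq u' 0.
  by rewrite su' eqxx.
have [n En _] := canonical_involution_norml u'.
case: (XF v' v n v'0 v0).
have := congr1 ( *%R v') E1; rewrite mulrDr mulrA mulr0.
rewrite -[v' * u]opprK (addr0_eq E2) mulNr -mulrA En -scalerAr mulr1 addrC.
by move/eqP; rewrite subr_eq0 => /eqP.
Qed.

End Doubling.

Theorem theorem11 (F : fieldType) (D : falgType F)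
    (hD : quaternion_algebra D) (hdiv : division_algebra (@amul F D))
    (sigma : {linear D -> D}) (hsigma : canonical_involution sigma)
    (c : D) (hc : c \is a GRing.unit) (hcF : c \notin 1%VS) :
  division_algebra (Cay sigma c) /\
  division_algebra (Cay_m sigma c) /\
  division_algebra (Cay_r sigma c).
Proof.
(* This is where [c] lying outside F enters; each case below ends by contradicting it. *)
have scaled_c (m k : F) : m != 0 -> m *: c <> k%:A.
  move=> m0 E; case/negP: hcF; apply/vlineP; exists (m^-1 * k).
  by rewrite -scalerA -E scalerA mulVf // scale1r.
have cancel_r (x k v : D) : v != 0 -> x * v = k * v -> x = k.
  by move=> /(proj2 hdiv)[_ /bij_inj]; apply.
have cancel_l (x k v : D) : v != 0 -> v * x = v * k -> x = k.
  by move=> /(proj2 hdiv)[/bij_inj inj _]; apply: inj.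
split; last split.
- apply: (@doubling_division_algebra _ _ _ hdiv hsigma
            (fun w v => c * sigma w * v)) => // [w|w v k w0 v0 E].
    exact: mulr0.
  have [m Em /(_ w0) m0] := canonical_involution_norml hdiv hsigma w.
  apply: (scaled_c m k m0); apply: (cancel_l _ _ w w0).
  (* After cancelling [v], multiplying by [w] on the right creates the norm [sigma w * w = m]; the
     leading [w] then cancels. *)
  have {}E : w * (c * sigma w) = k%:A.
    by apply: (cancel_r _ _ v v0); rewrite -mulrA E -scalerAl mul1r.
  have := congr1 ( *%R^~ w) E.
  by rewrite -!mulrA Em -!scalerAr -scalerAl !mulr1 mul1r.
- apply: (@doubling_division_algebra _ _ _ hdiv hsigma
            (fun w v => sigma w * c * v)) => // [w|w v k w0 v0 E].
    exact: mulr0.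
  have [m Em /(_ w0) m0] := canonical_involution_normr hdiv hsigma w.
  (* The norm [w * sigma w] appears at once, leaving [m c v = k v]. *)
  apply: (scaled_c m k m0); apply: (cancel_r _ _ v v0).
  by rewrite -!scalerAl mul1r -E !mulrA Em -!scalerAl mul1r.
- apply: (@doubling_division_algebra _ _ _ hdiv hsigma
            (fun w v => sigma w * v * c)) => // [w|w v k w0 v0 E].
    by rewrite mulr0 mul0r.
  have [m Em /(_ w0) m0] := canonical_involution_normr hdiv hsigma w.
  (* Now [c] stands to the right of [v], so [m v c = k v] is cancelled on the left. *)
  apply: (scaled_c m k m0); apply: (cancel_l _ _ v v0).
  by rewrite -!scalerAr mulr1 -E !mulrA Em -!scalerAl mul1r.
Qed.
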